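(* Let $D\subseteq 2^\omega$ be dense with $\aleph_0<|D|<2^{\aleph_0}$, and suppose there is an open set $U\subseteq 2^\omega$ such that $D\cap V$ is uncountable for every non-empty open $V\subseteq U$. Let $A=2^\omega\setminus D$. Then the quantifier $Q_A$ is not $\Sigma^1_1$-definable, i.e. the class $K_A$ of all $\tau_d$-structures $\mathcal M$ such that $\Omega(\mathcal M)\setminus A$ is dense is not the class of models of any $\Sigma^1_1$ sentence.
   Context: Let $\tau_d=\{R_0,R_1,R_2,R_3,R_4\}$ with $R_0,R_1,R_2$ binary and $R_3,R_4$ unary. For $n<\omega$ and $\eta\in 2^n$ let $\psi_\eta(x)$ be the first-order formula $R_4(x)\wedge\exists y_0\ldots\exists y_n\big(R_3(y_0)\wedge R_4(y_n)\wedge\bigwedge_{i<n}R_{\eta(i)}(y_i,y_{i+1})\wedge\bigwedge_{i\le n}R_2(y_i,x)\big)$. For a $\tau_d$-structure $\mathcal M$ and $a\in M$ let $\Omega(\mathcal M,a)=\{\eta\in 2^{<\omega}:\mathcal M\models\psi_\eta(a)\}$ and $\Omega(\mathcal M)=\{\eta\in 2^\omega:\exists a\in M\ \forall n<\omega\ \eta\restriction n\in\Omega(\mathcal M,a)\}$. A set $B\subseteq 2^\omega$ is dense if every $s\in 2^{<\omega}$ has an extension in $B$. $2^\omega$ carries the usual product (Cantor) topology. $\Sigma^1_1$ sentences are those of the form $\exists R_1\ldots\exists R_m\varphi$ with $\varphi$ first-order. *)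

(* Defs.v *)
From mathcomp Require Import all_boot.
From mathcomp Require Import boolp classical_sets cardinality.
From mathcomp Require Import topology cantor.

Set Implicit Arguments.
Unset Strict Implicit.
Unset Printing Implicit Defensive.

Local Open Scope classical_set_scope.
Local Open Scope card_scope.

Record vocabulary := Vocabulary { symbol : Type; arity : symbol -> nat }.

Record fo_structure (L : vocabulary) := FoStructure {
  carrier :> Type;
  carrier_inhabited : inhabited carrier;
  interp : forall R : symbol L, (arity R).-tuple carrier -> Prop
}.

(* Formulas with equality; the variables are named by natural numbers. *)
Inductive formula (L : vocabulary) : Type :=
| FTrue
| FEq of nat & nat
| FRel (R : symbol L) of (arity R).-tuple nat
| FNot of formula L
| FAnd of formula L & formula L
| FEx of nat & formula L.

Arguments FTrue {L}.
Arguments FEq {L} _ _.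
Arguments FRel {L} R _.

Definition update (T : Type) (v : nat -> T) (i : nat) (a : T) : nat -> T :=
  fun j => if j == i then a else v j.

Fixpoint sat (L : vocabulary) (M : fo_structure L) (v : nat -> M)
    (f : formula L) : Prop :=
  match f with
  | FTrue => True
  | FEq i j => v i = v j
  | FRel R t => interp (map_tuple v t)
  | FNot g => ~ sat v g
  | FAnd g h => sat v g /\ sat v h
  | FEx i g => exists a : M, sat (update v i a) g
  end.

Fixpoint free_vars (L : vocabulary) (f : formula L) : seq nat :=
  match f with
  | FTrue => [::]
  | FEq i j => [:: i; j]
  | FRel _ t => t
  | FNot g => free_vars g
  | FAnd g h => free_vars g ++ free_vars h
  | FEx i g => [seq j <- free_vars g | j != i]
  end.

Definition is_sentence (L : vocabulary) (f : formula L) : Prop :=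
  free_vars f = [::].

Definition models_sentence (L : vocabulary) (M : fo_structure L)
    (f : formula L) : Prop :=
  forall v : nat -> M, sat v f.

Definition FConj (L : vocabulary) (s : seq (formula L)) : formula L :=
  foldr (@FAnd L) FTrue s.

Definition FExs (L : vocabulary) (xs : seq nat) (f : formula L) : formula L :=
  foldr (@FEx L) f xs.

(* [ar] lists the arities of the new relation symbols. *)
Definition extend_vocabulary (L : vocabulary) (ar : seq nat) : vocabulary :=
  @Vocabulary (symbol L + 'I_(size ar))
    (fun R => match R with inl P => arity P | inr i => nth 0 ar i end).

Definition expansion (L : vocabulary) (M : fo_structure L) (ar : seq nat)
    (X : forall i : 'I_(size ar), (nth 0 ar i).-tuple M -> Prop) :
    fo_structure (extend_vocabulary L ar) :=
  @FoStructure (extend_vocabulary L ar) M (carrier_inhabited M)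
    (fun R => match R return
         (@arity (extend_vocabulary L ar) R).-tuple M -> Prop with
       | inl P => @interp L M P
       | inr i => X i
       end).

(* Second-order existential quantification over [size so_arities] relations,
   in front of a first-order sentence of the extended vocabulary. *)
Record sigma11_sentence (L : vocabulary) := Sigma11Sentence {
  so_arities : seq nat;
  so_matrix : formula (extend_vocabulary L so_arities);
  so_matrix_sentence : is_sentence so_matrix
}.

Definition models_sigma11 (L : vocabulary) (M : fo_structure L)
    (phi : sigma11_sentence L) : Prop :=
  exists X : forall i : 'I_(size (so_arities phi)),
      (nth 0 (so_arities phi) i).-tuple M -> Prop,
    models_sentence (expansion X) (so_matrix phi).

Definition sigma11_definable (L : vocabulary) (K : set (fo_structure L)) : Prop :=
  exists phi : sigma11_sentence L,
    forall M : fo_structure L, K M <-> models_sigma11 M phi.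

Inductive symbol_d := R0 | R1 | R2 | R3 | R4.

Definition arity_d (R : symbol_d) : nat :=
  match R with R0 | R1 | R2 => 2 | R3 | R4 => 1 end.

Definition tau_d : vocabulary := Vocabulary arity_d.

(* The variable x is 0 and y_i is i.+1; false selects R0 and true selects R1. *)
Definition psi (eta : seq bool) : formula tau_d :=
  let n := size eta in
  let x := 0 in
  let y i := i.+1 in
  FAnd (@FRel tau_d R4 [tuple x])
    (FExs [seq y i | i <- iota 0 n.+1]
      (FAnd (@FRel tau_d R3 [tuple y 0])
      (FAnd (@FRel tau_d R4 [tuple y n])
      (FAnd (FConj [seq if nth false eta i
                        then @FRel tau_d R1 [tuple y i; y i.+1]
                        else @FRel tau_d R0 [tuple y i; y i.+1]
                   | i <- iota 0 n])
            (FConj [seq @FRel tau_d R2 [tuple y i; x] | i <- iota 0 n.+1]))))).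

(* Only the variable 0 is free in [psi eta], hence the constant assignment. *)
Definition Omega_at (M : fo_structure tau_d) (a : M) : set (seq bool) :=
  [set eta | sat (fun=> a) (psi eta)].

Definition restr (eta : cantor_space) (n : nat) : seq bool := mkseq eta n.

Definition Omega (M : fo_structure tau_d) : set cantor_space :=
  [set eta | exists a : M, forall n : nat, Omega_at a (restr eta n)].

Definition seq_dense (B : set cantor_space) : Prop :=
  forall s : seq bool, exists2 eta, B eta & restr eta (size s) = s.

Definition K_ (A : set cantor_space) : set (fo_structure tau_d) :=
  [set M | seq_dense (Omega M `\` A)].

Definition card_lt (T U : Type) (A : set T) (B : set U) : Prop :=
  A #<= B /\ ~ (B #<= A).

(* Main.v *)
Require Import Defs.
From mathcomp Require Import all_boot.
From mathcomp Require Import boolp classical_sets cardinality.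
From mathcomp Require Import topology cantor.
Set Implicit Arguments.
Unset Strict Implicit.
Unset Printing Implicit Defensive.
Local Open Scope classical_set_scope.

(* Let [s0] be a node with [cone s0] inside the open set on which [D] is nowhere
   countable. The countable structures consisting of the tree 2^<omega and of a
   countable family of branches belong to the class iff the family meets [D] in
   a dense set. If the class were Sigma^1_1, the families with this property
   would be the projection of a closed subset of Baire space, whose points code
   a family, witnesses of the second-order quantifiers and Skolem witnesses for
   the first-order part. Fix the branches outside [cone s0] and let the others
   vary: since [D] is uncountable in every cone below [s0], no countable set hits
   all families. A fusion argument then produces a perfect set of such families
   that are pairwise disjoint. Each of them has a member in [D], so [D] has the
   power of the continuum. *)

(** * Topology of Baire space through finite prefixes *)

(** Continuity on Baire space for the discrete topology on [V]; with [V = Prop] it describes clopen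
    sets. *)
Definition locally_const (V : Type) (h : (nat -> nat) -> V) : Prop :=
  forall z, exists n, forall z', mkseq z' n = mkseq z n -> h z' = h z.

Definition baire_closed (F : set (nat -> nat)) : Prop :=
  forall z, (forall n, exists2 z', F z' & mkseq z' n = mkseq z n) -> F z.

Lemma eq_mkseqP (V : Type) (f g : nat -> V) n :
  mkseq f n = mkseq g n <-> forall k, k < n -> f k = g k.
Proof.
split=> [e k kn|e]; first by rewrite -(nth_mkseq (g k) f kn) e nth_mkseq.
elim: n e => // n IH e; rewrite !mkseqS e ?IH // => k kn.
by apply: e; exact: ltnW.
Qed.

Lemma eq_mkseqW (V : Type) (f g : nat -> V) m n :
  m <= n -> mkseq f n = mkseq g n -> mkseq f m = mkseq g m.
Proof.
move=> mn /eq_mkseqP e; apply/eq_mkseqP => k km; apply: e.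
exact: leq_trans mn.
Qed.

Lemma prefix_mkseq (V : eqType) (f : nat -> V) m n :
  m <= n -> prefix (mkseq f m) (mkseq f n).
Proof.
elim: n => [|n IH]; first by case: m.
rewrite leq_eqVlt => /predU1P[->|mn]; first exact: prefix_refl.
by rewrite mkseqS; apply: prefix_trans (prefix_rcons _ _); apply: IH.
Qed.

(** * Fusion: a perfect set of pairwise disjoint countable families *)

Section PerfectFamily.
Variables (I : countType) (F : set (nat -> nat)).
Variable pt : I -> (nat -> nat) -> nat -> bool.
Hypothesis F_closed : baire_closed F.
Hypothesis pt_continuous : forall i k, locally_const (fun z => pt i z k).
Hypothesis F_unhit : forall C : set (nat -> bool), countable C ->
  exists2 z, F z & forall i, ~ C (pt i z).

Let cyl (s : seq nat) : set (nat -> nat) :=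
  [set z | F z /\ mkseq z (size s) = s].
(** Small cylinders are what the fusion must avoid, like the countable pieces in a Cantor-Bendixson
    argument. *)
Let small s := exists2 C : set (nat -> bool), countable C &
  forall z, cyl s z -> exists i, C (pt i z).
Let good (t : seq bool -> seq nat) := forall a, ~ small (t a).
Let refines (t t' : seq bool -> seq nat) := forall a, prefix (t a) (t' a).
(** A single requirement of the fusion. It is void for equal words, since nothing is claimed about
    two members of one family. *)
Let separated (t : seq bool -> seq nat) (r : seq bool * seq bool * I * I) :=
  r.1.1.1 != r.1.1.2 -> forall z z', cyl (t r.1.1.1) z -> cyl (t r.1.1.2) z' ->
    pt r.1.2 z <> pt r.2 z'.

Lemma cyl_sub s s' : prefix s s' -> cyl s' `<=` cyl s.
Proof.
move=> ss' z [Fz e]; split=> //; apply/(@eq_from_nth _ 0).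
  by rewrite size_mkseq.
move=> k; rewrite size_mkseq => kn; rewrite nth_mkseq //.
case/prefixP: ss' e => u -> e.
move: (congr1 (nth 0 ^~ k) e); rewrite nth_cat kn nth_mkseq // size_cat.
exact: ltn_addr.
Qed.

(* Adding to [C] hitting sets for the countably many small cylinders yields a
   point none of whose cylinders is small. *)
Lemma unhit_good s (C : set (nat -> bool)) : ~ small s -> countable C ->
  exists z, [/\ cyl s z, forall n, ~ small (mkseq z n) & forall i, ~ C (pt i z)].
Proof.
move=> bs cC; apply: contrapT => nz; apply: bs.
pose K s' := xget set0 [set E | countable E /\
  forall z, cyl s' z -> exists i, E (pt i z)].
exists (\bigcup_o if o is Some s' then K s' else C).
  apply: bigcup_countable => // -[s'|//] _.
  by rewrite /K; case: xgetP => [_ _ []|_]//; exact: countable0.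
move=> z zs; apply: contrapT => nh; apply: nz; exists z; split=> //.
- move=> n sm; apply: nh.
  have [E cE hE] := sm.
  have [i Ki] : exists i, K (mkseq z n) (pt i z).
    rewrite /K; case: xgetP => [E' _ [_ hE']|/(_ E)[]//].
    by apply: hE'; split; [case: zs | rewrite size_mkseq].
  by exists i; exists (Some (mkseq z n)).
- by move=> i Ci; apply: nh; exists i; exists None.
Qed.

Lemma prefix_cyl s z n : cyl s z -> size s <= n -> prefix s (mkseq z n).
Proof. by move=> [_ {2}<-] sn; exact: prefix_mkseq. Qed.

(* If no separating extensions existed, [pt i] on the first cylinder and [pt j]
   on the second would be one constant, which would hit the cylinder. *)
Lemma separate_pair s s' i j : ~ small s -> ~ small s' ->
  exists t t', [/\ ~ small t, ~ small t', prefix s t, prefix s' t' &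
    forall z z', cyl t z -> cyl t' z' -> pt i z <> pt j z'].
Proof.
move=> bs bs'; have [z' [zs' gz' _]] := unhit_good bs' (countable0 _).
have [z [zs gz /(_ i) npt]] := unhit_good bs (countable1 (pt j z')).
have [k nk] : exists k, pt i z k <> pt j z' k.
  by apply/existsNP => e; apply: npt; apply/funext.
have [n hn] := pt_continuous i k z; have [n' hn'] := pt_continuous j k z'.
exists (mkseq z (maxn n (size s))), (mkseq z' (maxn n' (size s'))).
split=> //; [exact: prefix_cyl (leq_maxr _ _)|exact: prefix_cyl (leq_maxr _ _)|].
move=> w w' [_]; rewrite size_mkseq => e [_]; rewrite size_mkseq => e'.
move=> /(congr1 (fun f => f k)).
rewrite hn; last exact: eq_mkseqW (leq_maxl _ _) e.
by rewrite hn'; last exact: eq_mkseqW (leq_maxl _ _) e'.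
Qed.

Lemma refines_trans t t' t'' : refines t t' -> refines t' t'' -> refines t t''.
Proof. by move=> h h' a; exact: prefix_trans (h a) (h' a). Qed.

Lemma separated_refines t t' r : refines t t' -> separated t r -> separated t' r.
Proof.
move=> tt' sep /sep{}sep z z' zs zs'.
by apply: sep; [move: zs|move: zs']; exact: cyl_sub.
Qed.

Lemma separate_one t r : good t ->
  exists t', [/\ good t', refines t t' & separated t' r].
Proof.
case: r => [[[a b] i] j] gt; have [<-{b}|ab] := eqVneq a b.
  by exists t; split=> // [c|]; [exact: prefix_refl|rewrite /separated eqxx].
have [s [s' [bs bs' ps ps' h]]] := separate_pair i j (gt a) (gt b).
exists (fun c => if c == a then s else if c == b then s' else t c); split.
- by move=> c; case: ifP => // _; case: ifP.
- move=> c; case: eqVneq => [->//|_]; case: eqVneq => [->//|_].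
  exact: prefix_refl.
- by rewrite /separated /= !eqxx (eq_sym b) (negbTE ab).
Qed.

Lemma separate_all t (rs : seq (seq bool * seq bool * I * I)) : good t ->
  exists t', [/\ good t', refines t t' & forall r, r \in rs -> separated t' r].
Proof.
move=> gt; elim: rs => [|r rs [u [gu tu hu]]].
  by exists t; split=> // c; exact: prefix_refl.
have [u' [gu' uu' hu']] := separate_one r gu.
exists u'; split=> //; first exact: refines_trans uu'.
by move=> q; rewrite inE => /predU1P[->//|/hu]; exact: separated_refines.
Qed.

(** Bounding the codes of [i] and [j] by [n] leaves finitely many requirements at each level, while
    every pair of indices is treated from some level on. *)
Let level n t := [/\ good t, forall a, n <= size (t a) &
  forall a b i j, size a = n -> size b = n -> pickle i < n -> pickle j < n ->
    separated t (a, b, i, j)].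

Lemma next_level n t : exists t', level n t -> level n.+1 t' /\
  forall a, prefix (t (take n a)) (t' a).
Proof.
(* Off [level n t] the claim is vacuous; this form lets choice produce a total step function. *)
have [[gt st _]|nl] := pselect (level n t); last by exists t.
pose words := map val (enum {: n.+1.-tuple bool}).
pose small_idx := pmap (fun k => @unpickle I k) (iota 0 n.+1).
have lengthen s : exists s', ~ small s ->
    [/\ ~ small s', prefix s s' & size s < size s'].
  have [ss|bs] := pselect (small s); first by exists s.
  have [z [zs gz _]] := unhit_good bs (countable0 _).
  exists (mkseq z (size s).+1) => _.
  by rewrite size_mkseq; split=> //; exact: prefix_cyl.
have {lengthen}[e he] := choice lengthen.
have gt1 : good (fun a => e (t (take n a))).
  by move=> a; case: (he _ (gt (take n a))).
have [t' [gt' tt' ht']] := separate_all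
  [seq (p, j) | p <- [seq (q, i) | q <- [seq (a, b) | a <- words, b <- words],
                                   i <- small_idx], j <- small_idx] gt1.
have e_t' a : prefix (e (t (take n a))) (t' a) by exact: tt'.
exists t'; split=> [|a]; last first.
  by apply: prefix_trans (e_t' a); case: (he _ (gt (take n a))).
split=> // [a|a b i j sa sb ni nj].
  apply: leq_trans (size_prefix (e_t' a)).
  by case: (he _ (gt (take n a))) => _ _; apply: leq_ltn_trans.
have in_words c : size c = n.+1 -> c \in words.
  by move=> /eqP sc; apply/mapP; exists (Tuple sc); rewrite ?mem_enum.
have in_idx k : pickle k < n.+1 -> k \in small_idx.
  by move=> kn; rewrite mem_pmap; apply/mapP; exists (pickle k);
    rewrite ?mem_iota ?pickleK.
by apply: ht'; do !apply: allpairs_f;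
  [exact: in_words..|exact: in_idx|exact: in_idx].
Qed.

Lemma chain_limit (s : nat -> seq nat) : (forall n, prefix (s n) (s n.+1)) ->
  (forall n, n <= size (s n)) -> exists z, forall n, mkseq z (size (s n)) = s n.
Proof.
move=> s_chain s_size.
have s_mono m n : m <= n -> prefix (s m) (s n).
  elim: n => [|n IH]; first by case: m => // _; exact: prefix_refl.
  rewrite leq_eqVlt => /predU1P[->|mn]; first exact: prefix_refl.
  exact: prefix_trans (IH mn) (s_chain n).
(* Entry [k] is read from [s k.+1], which is long enough to contain it. *)
exists (fun k => nth 0 (s k.+1) k) => n; apply: (@eq_from_nth _ 0).
  by rewrite size_mkseq.
move=> k; rewrite size_mkseq => kn; rewrite nth_mkseq //.
have nth_prefix u v : prefix u v -> k < size u -> nth 0 u k = nth 0 v k.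
  by case/prefixP => w -> ku; rewrite nth_cat ku.
have /orP[le|le] := leq_total n k.+1; last by apply: nth_prefix (s_mono _ _ le) _.
by apply/esym; apply: nth_prefix (s_mono _ _ le) kn.
Qed.

Lemma perfect_separated_family : exists G : (nat -> bool) -> (nat -> nat),
  (forall a, F (G a)) /\
  (forall a b i j, a <> b -> pt i (G a) <> pt j (G b)).
Proof.
have [next hnext] := choice (fun p => next_level p.1 p.2).
pose T := fix T n := if n is m.+1 then next (m, T m) else fun=> [::].
have T_level n : level n (T n).
  elim: n => [|n IH]; last by case: (hnext (n, T n) IH).
  (* At level 0 every prefix is empty, and a small empty prefix would give a countable set hitting
     all of [F]. *)
  split=> // a [C cC hC]; have [z Fz hz] := F_unhit cC.
  have [i Ci] : exists i, C (pt i z) by apply: hC.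
  exact: hz Ci.
have T_chain a n : prefix (T n (mkseq a n)) (T n.+1 (mkseq a n.+1)).
  have [_ h] := hnext (n, T n) (T_level n); move: (h (mkseq a n.+1)).
  by rewrite /= mkseqS -cats1 take_size_cat ?size_mkseq.
have T_size a n : n <= size (T n (mkseq a n)) by case: (T_level n).
have [G hG] := choice (fun a => chain_limit (T_chain a) (T_size a)).
have FG a : F (G a).
  (* A cylinder that is not small contains a point of [F], so [G a] is a limit of points of [F]. *)
  apply: F_closed => n; have [gT _ _] := T_level n.
  have [z [[Fz ez] _ _]] := unhit_good (gT (mkseq a n)) (countable0 _).
  by exists z => //; apply: eq_mkseqW (T_size a n) _; rewrite ez hG.
exists G; split=> // a b i j ab.
have [k kab] : exists k, a k <> b k.
  by apply/existsNP => e; apply: ab; apply/funext.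
(* At this level the two words already differ and both indices are taken into account. *)
pose n := (maxn k (maxn (pickle i) (pickle j))).+1.
have [_ _ sep] := T_level n.
apply: (sep (mkseq a n) (mkseq b n) i j); rewrite ?size_mkseq //=.
- by rewrite ltnS !leq_max leqnn orbT.
- by rewrite ltnS !leq_max leqnn !orbT.
- by apply/eqP => /eq_mkseqP e; apply: kab; apply: e; rewrite ltnS leq_maxl.
- exact: conj (FG a) (hG a n).
- exact: conj (FG b) (hG b n).
Qed.
End PerfectFamily.

(** * Closure properties of locally constant maps and closed sets *)

Lemma locally_const_cst (V : Type) (c : V) : locally_const (fun=> c).
Proof. by move=> z; exists 0. Qed.

(** Near a point [g] keeps one value, so only [h] at that fixed argument matters. *)
Lemma locally_const_app (V W : Type) (h : (nat -> nat) -> V -> W)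
    (g : (nat -> nat) -> V) :
  (forall c, locally_const (h ^~ c)) -> locally_const g ->
  locally_const (fun z => h z (g z)).
Proof.
move=> lh lg z; have [m hm] := lg z; have [n hn] := lh (g z) z.
exists (maxn m n) => z' e.
rewrite hm; last exact: eq_mkseqW (leq_maxl _ _) e.
by rewrite hn //; exact: eq_mkseqW (leq_maxr _ _) e.
Qed.

Lemma locally_const_comp (V W : Type) (u : V -> W) (g : (nat -> nat) -> V) :
  locally_const g -> locally_const (fun z => u (g z)).
Proof.
by apply: (locally_const_app (h := fun=> u)) => c; exact: locally_const_cst.
Qed.

Lemma locally_const_comp2 (V1 V2 W : Type) (u : V1 -> V2 -> W)
    (g1 : (nat -> nat) -> V1) (g2 : (nat -> nat) -> V2) :
  locally_const g1 -> locally_const g2 ->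
  locally_const (fun z => u (g1 z) (g2 z)).
Proof.
move=> lg1; apply: (locally_const_app (h := fun z => u (g1 z))) => c.
exact: (locally_const_comp (u^~ c)).
Qed.

Lemma locally_const_eval k : locally_const (fun z => z k).
Proof.
move=> z; exists k.+1 => z' /eq_mkseqP; apply; exact: ltnSn.
Qed.

Lemma locally_const_mkseq (V : Type) (g : (nat -> nat) -> nat -> V) n :
  (forall k, locally_const (g ^~ k)) -> locally_const (fun z => mkseq (g z) n).
Proof.
move=> lg; elim: n => [|n IH]; first exact: locally_const_cst.
under [X in locally_const X]funext do rewrite mkseqS.
exact: locally_const_comp2.
Qed.

Lemma baire_closed_locally_const (P : (nat -> nat) -> Prop) :
  locally_const P -> baire_closed P.
Proof. by move=> lP z cz; have [n hn] := lP z; have [z' + /hn <-] := cz n. Qed.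

Lemma baire_closedI (P Q : set (nat -> nat)) :
  baire_closed P -> baire_closed Q -> baire_closed (fun z => P z /\ Q z).
Proof.
move=> cP cQ z cz; split; [apply: cP|apply: cQ] => n;
  by have [z' [Pz Qz] e] := cz n; exists z'.
Qed.

Lemma baire_closed_forall (T : Type) (P : T -> set (nat -> nat)) :
  (forall t, baire_closed (P t)) -> baire_closed (fun z => forall t, P t z).
Proof.
by move=> cP z cz t; apply: cP => n; have [z' Pz e] := cz n; exists z'.
Qed.

(** * Truth tables with Skolem witnesses *)

Section TruthAssignments.
(* The carrier is enumerated by [dec] instead of being a [countType] because the
   universe of [countType] is too large for [fo_structure]. *)
Variables (L : vocabulary) (U : Type) (dec : nat -> U).

(** Finite lists keep the assignments countable in number; variables past the end take the value
    [dec 0]. *)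
Definition assign (v : seq nat) (i : nat) : U := dec (nth 0 v i).

(* [t p v] codes the truth value, under the assignment [assign v], of the
   subformula of [g] at the position [p]: it is nonzero iff the subformula
   holds, and for a true existential formula it is one more than a code of a
   witness. In this way a quantifier is subject to conditions each of which
   involves only two values of [t]. *)
Fixpoint coherent (at_ : symbol L -> seq nat -> bool) (g : formula L)
    (t : seq bool -> seq nat -> nat) : Prop :=
  match g with
  | FTrue => forall v, (t [::] v != 0) = true
  | FEq i j => forall v, (t [::] v != 0) = `[< assign v i = assign v j >]
  | FRel R s => forall v, (t [::] v != 0) = at_ R (map (nth 0 v) s)
  | FNot h => coherent at_ h (t \o cons false) /\
      forall v, (t [::] v != 0) = (t [:: false] v == 0)
  | FAnd h k => [/\ coherent at_ h (t \o cons false),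
      coherent at_ k (t \o cons true) &
      forall v, (t [::] v != 0) = (t [:: false] v != 0) && (t [:: true] v != 0)]
  | FEx i h => coherent at_ h (t \o cons false) /\
      forall v, (forall n, t [::] v = 0 -> t [:: false] (set_nth 0 v i n) = 0) /\
        (forall n, t [::] v = n.+1 -> t [:: false] (set_nth 0 v i n) <> 0)
  end.

(** Once the list and the witness code are fixed, each condition reads finitely many locally
    constant values and is clopen; coherence is an intersection of such conditions. *)
Lemma coherent_closed at_ g (t : (nat -> nat) -> seq bool -> seq nat -> nat) :
  (forall R s, locally_const (fun z => at_ z R s)) ->
  (forall p v, locally_const (fun z => t z p v)) ->
  baire_closed (fun z => coherent (at_ z) g (t z)).
Proof.
move=> lat; elim: g t => [|i j|R s|h IH|h IHh k IHk|i h IH] t lt /=.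
- apply: baire_closed_forall => v; apply: baire_closed_locally_const.
  exact: (locally_const_comp (fun n => (n != 0) = true)).
- apply: baire_closed_forall => v; apply: baire_closed_locally_const.
  exact: (locally_const_comp (fun n => (n != 0) = _)).
- apply: baire_closed_forall => v; apply: baire_closed_locally_const.
  exact: (locally_const_comp2 (fun n b => (n != 0) = b)).
- apply: baire_closedI; first
    exact: (IH (fun z => t z \o cons false) (fun p => lt (false :: p))).
  apply: baire_closed_forall => v; apply: baire_closed_locally_const.
  exact: (locally_const_comp2 (fun m n => (m != 0) = (n == 0))).
- suff : baire_closed (fun z => coherent (at_ z) h (t z \o cons false) /\
      (coherent (at_ z) k (t z \o cons true) /\
      forall v, (t z [::] v != 0) =
        (t z [:: false] v != 0) && (t z [:: true] v != 0))).
    by congr baire_closed; apply/funext => z; apply/propext;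
      split=> [[? [? ?]]|[? ? ?]].
  apply: baire_closedI; first
    exact: (IHh (fun z => t z \o cons false) (fun p => lt (false :: p))).
  apply: baire_closedI; first
    exact: (IHk (fun z => t z \o cons true) (fun p => lt (true :: p))).
  apply: baire_closed_forall => v; apply: baire_closed_locally_const.
  apply: (locally_const_comp2 (fun m b => (m != 0) = b)) => //.
  exact: (locally_const_comp2 (fun m n => (m != 0) && (n != 0))).
- apply: baire_closedI; first
    exact: (IH (fun z => t z \o cons false) (fun p => lt (false :: p))).
  apply: baire_closed_forall => v; apply: baire_closedI;
    apply: baire_closed_forall => a; apply: baire_closed_locally_const.
    exact: (locally_const_comp2 (fun m n => m = 0 -> n = 0)).
  exact: (locally_const_comp2 (fun m n => m = a.+1 -> n <> 0)).
Qed.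

Variables (U_inh : inhabited U) (at_ : symbol L -> seq nat -> bool).
Variable rel_interp : forall R : symbol L, (arity R).-tuple U -> Prop.
Hypothesis dec_surj : forall a, exists n, dec n = a.
Hypothesis rel_interpE : forall R s,
  rel_interp (R := R) (map_tuple dec s) <-> at_ R s.
Let M := FoStructure U_inh rel_interp.

Lemma assign_set_nth v i n : assign (set_nth 0 v i n) = update (assign v) i (dec n).
Proof.
by apply/funext => j; rewrite /assign /update nth_set_nth /=; case: eqP.
Qed.

(** At a true existential formula the table supplies a witness; conversely, any witness has a code
    because [dec] is surjective. *)
Lemma coherent_sat g t : coherent at_ g t ->
  forall v, t [::] v != 0 <-> sat (M := M) (assign v) g.
Proof.
elim: g t => [|i j|R s|h IH|h IHh k IHk|i h IH] t /=.
- by move=> ct v; rewrite ct.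
- by move=> ct v; rewrite ct; split=> /asboolP.
- move=> ct v; rewrite ct -(rel_interpE (map_tuple (nth 0 v) s)).
  suff -> : map_tuple dec (map_tuple (nth 0 v) s) = map_tuple (assign v) s by [].
  by apply: val_inj; rewrite /= -map_comp.
- by move=> [/IH{}IH ct] v; rewrite ct -IH /=; split=> [/eqP->|/negP/negPn].
- move=> [/IHh{}IHh /IHk{}IHk ct] v; rewrite ct -IHh -IHk.
  by split=> /andP.
- move=> [/IH{}IH ct] v; have [ct0 ctS] := ct v; split.
    case e : (t [::] v) => [//|n] _; exists (dec n).
    by rewrite -assign_set_nth -IH; apply/eqP; exact: ctS.
  move=> [a]; have [n <-] := dec_surj a; rewrite -assign_set_nth -IH => tn.
  by apply/eqP => /ct0 tn0; move: tn; rewrite /= tn0.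
Qed.

(** The tables of the immediate subformulas are glued below a new root; for an existential formula
    the root chooses a witness code. *)
Lemma exists_coherent g : exists t, coherent at_ g t.
Proof.
pose glue root th tk (p : seq bool) : seq nat -> nat :=
  match p with [::] => root | b :: q => if b then tk q else th q end.
elim: g => [|i j|R s|h [th ch]|h [th ch] k [tk ck]|i h [th ch]].
- by exists (fun _ _ => 1).
- exists (fun _ v => `[< assign v i = assign v j >] : nat) => v.
  by case: (asbool _).
- exists (fun _ v => at_ R (map (nth 0 v) s)) => v.
  by case: (at_ _ _).
- exists (glue (fun v => th [::] v == 0 : nat) th th); split=> // v.
  by rewrite /=; case: (th _ _ == 0).
- exists (glue (fun v => (th [::] v != 0) && (tk [::] v != 0) : nat) th tk).
  by split=> // v; rewrite /=; case: (_ && _).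
- pose w v := if pselect (exists n, th [::] (set_nth 0 v i n) != 0) is left e
    then (xchoose e).+1 else 0.
  exists (glue w th th); split=> // v; rewrite /w /=.
  case: pselect => [e|ne]; split=> // n.
    by case=> <-; apply/eqP; exact: xchooseP e.
  by move=> _; apply/eqP; apply: contrapT => /negP tn; apply: ne; exists n.
Qed.

End TruthAssignments.

(** * Satisfaction depends only on the free variables *)

Lemma sat_free_vars (L : vocabulary) (M : fo_structure L) (g : formula L)
    (v w : nat -> M) :
  {in free_vars g, v =1 w} -> sat v g <-> sat w g.
Proof.
elim: g v w => [|i j|R s|h IH|h IHh k IHk|i h IH] v w /= e.
- by [].
- by rewrite !e ?inE ?eqxx ?orbT.
- suff -> : map_tuple v s = map_tuple w s by [].
  by apply: val_inj => /=; apply/eq_in_map.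
- by rewrite (IH v w).
- by rewrite (IHh v w) ?(IHk v w) // => i hi; apply: e; rewrite mem_cat hi ?orbT.
- suff h1 a : sat (update v i a) h <-> sat (update w i a) h.
    by split=> -[a /h1]; exists a.
  apply: IH => j hj; rewrite /update; case: eqVneq => // ji.
  by apply: e; rewrite mem_filter ji.
Qed.

Lemma sat_sentence (L : vocabulary) (M : fo_structure L) (g : formula L)
    (v w : nat -> M) : is_sentence g -> sat v g -> sat w g.
Proof. by move=> g0 /(sat_free_vars (w := w)); apply=> i; rewrite g0. Qed.

(** * Cones in Cantor space *)

Definition cone (s : seq bool) : set cantor_space :=
  [set x | restr x (size s) = s].

Lemma cone_open s : open (cone s).
Proof.
elim/last_ind: s => [|s b IH].
  suff -> : cone [::] = setT by exact: openT.
  by apply/seteqP; split.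
have -> : cone (rcons s b) = cone s `&` [set x : cantor_space | x (size s) = b].
  apply/seteqP; split=> x; rewrite /cone /= size_rcons /restr mkseqS.
    by move=> /rcons_inj[].
  by move=> [-> ->].
apply: openI => //; apply: (@open_comp _ _ (fun x : cantor_space => x (size s))
  [set b]); last exact: discrete_open.
by move=> x _; exact: (@proj_continuous nat (fun=> bool) (size s)).
Qed.

Lemma open_sub_cone (U : set cantor_space) x :
  open U -> U x -> exists n, cone (restr x n) `<=` U.
Proof.
move=> oU Ux; apply: contrapT => nU.
(* Points outside [U] that share longer and longer prefixes with [x] would converge to [x]. *)
have out n : exists y : cantor_space, cone (restr x n) y /\ ~ U y.
  apply: contrapT => ny; apply: nU; exists n => y xy.
  by apply: contrapT => Uy; apply: ny; exists y.
have [y hy] := choice out.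
have y_x : {ptws, y @ \oo --> (x : nat -> bool)}.
  apply/pointwise_cvgP => k; rewrite discrete_cvg.
  exists k.+1 => // n /= kn; have [+ _] := hy n.
  rewrite /cone /= size_mkseq => /eq_mkseqP; exact.
have [N _ /(_ N (leqnn N))] := y_x U (open_nbhs_nbhs (conj oU Ux)).
by case: (hy N).
Qed.

(** * Tree structures and their branches *)

Definition node : Type := (seq bool + seq bool)%type.

(* [inl s] is the node [s] of the binary tree; [inr b] is a branch named [b],
   namely [f b]. *)
Definition tree_rel (f : seq bool -> nat -> bool) (R : symbol_d)
    (l : seq node) : bool :=
  match R, l with
  | R0, [:: inl s; inl s'] => s' == rcons s false
  | R1, [:: inl s; inl s'] => s' == rcons s true
  | R2, [:: inl s; inr b] => s == mkseq (f b) (size s)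
  | R3, [:: inl s] => s == [::]
  | R4, _ => true
  | _, _ => false
  end.

Definition tree_structure (f : seq bool -> nat -> bool) : fo_structure tau_d :=
  @FoStructure tau_d node (inhabits (inl [::])) (fun R t => tree_rel f R t).

Lemma sat_FAnd (L : vocabulary) (M : fo_structure L) (v : nat -> M) g h :
  sat v (FAnd g h) <-> sat v g /\ sat v h.
Proof. by []. Qed.

Lemma sat_FConj (L : vocabulary) (M : fo_structure L) (v : nat -> M)
    (I : eqType) (F : I -> formula L) (r : seq I) :
  sat v (FConj [seq F i | i <- r]) <-> forall i, i \in r -> sat v (F i).
Proof.
elim: r => [|i r IH] /=; first by [].
rewrite IH; split=> [[hi h] j|h].
  by rewrite inE => /predU1P[->//|/h].
by split=> [|j jr]; apply: h; rewrite inE ?eqxx ?jr ?orbT.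
Qed.

Lemma sat_FExs (L : vocabulary) (M : fo_structure L) (v : nat -> M) xs g :
  sat v (FExs xs g) <->
  exists2 w, (forall i, i \notin xs -> w i = v i) & sat w g.
Proof.
elim: xs v => [|x xs IH] v /=.
  split=> [h|[w e h]]; first by exists v.
  by have <- : w = v by apply/funext => i; exact: e.
split=> [[a /IH[w e h]]|[w e h]].
  exists w => // i; rewrite inE negb_or => /andP[ix ixs].
  by rewrite e // /update (negbTE ix).
exists (w x); apply/IH; exists w => // i ixs; rewrite /update.
by case: eqVneq => [->//|ix]; apply: e; rewrite inE negb_or ix.
Qed.

(** [R3] puts [y_0] at the root and [R0], [R1] then force each [y_i] to be the prefix of [eta] of
    length [i]; [R2] at [y_n] makes [x] a branch through [eta]. *)
Lemma Omega_at_tree f (a : tree_structure f) eta :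
  Omega_at a eta <-> exists2 b, a = inr b & mkseq (f b) (size eta) = eta.
Proof.
rewrite /Omega_at /psi /mkset; set n := size eta; split.
  move=> /sat_FAnd[_ /sat_FExs[w w0]].
  move=> /sat_FAnd[y0 /sat_FAnd[_ /sat_FAnd[/sat_FConj yE /sat_FConj yx]]].
  have {}w0 : w 0 = a by apply: w0; apply/mapP => -[].
  have y_take i : i <= n -> w i.+1 = inl (take i eta).
    elim: i => [_|i IH ilt].
      have : tree_rel f R3 [:: w 1] by exact: y0.
      by rewrite /= take0; case: (w 1) => // s /eqP ->.
    have := yE i; rewrite mem_iota => /(_ ilt) yEi.
    have : tree_rel f (if nth false eta i then R1 else R0) [:: w i.+1; w i.+2].
      by case: (nth _ _ _) yEi.
    rewrite (take_nth false) // (IH (ltnW ilt)).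
    by case: (nth _ _ _) => /=; case: (w i.+2) => // s /eqP ->.
  have := yx n; rewrite mem_iota add0n ltnSn => /(_ isT) yxn.
  have : tree_rel f R2 [:: w n.+1; w 0] by exact: yxn.
  rewrite w0 y_take // take_size; case: a {w0} => // b /eqP e.
  by exists b.
move=> [b -> e]; split=> //; apply/sat_FExs.
(* Outside the quantified variables [w] has to keep the constant value [inr b]. *)
pose w i : node :=
  if i is j.+1 then if j <= n then inl (take j eta) else inr b else inr b.
have wE i : i <= n -> w i.+1 = inl (take i eta) by rewrite /w => ->.
exists w.
  case=> // i; rewrite mem_map; last by move=> ? ? [].
  by rewrite mem_iota /= ltnS /w => /negbTE ->.
apply/sat_FAnd; split.
  by rewrite -/(is_true (tree_rel f R3 [:: w 1])) /= take0.
apply/sat_FAnd; split=> //; apply/sat_FAnd; split; apply/sat_FConj => i.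
  rewrite mem_iota => /= ilt.
  suff : tree_rel f (if nth false eta i then R1 else R0) [:: w i.+1; w i.+2].
    by case: (nth _ _ _).
  rewrite !wE ?(ltnW ilt) // (take_nth false) //.
  by case: (nth _ _ _); rewrite /= eqxx.
rewrite mem_iota ltnS => /= ilt.
suff : tree_rel f R2 [:: w i.+1; w 0] by [].
by rewrite wE //= size_takel // -e /mkseq -map_take take_iota (minn_idPl ilt).
Qed.

Lemma Omega_tree f (eta : cantor_space) :
  Omega (tree_structure f) eta <-> exists b, eta = f b.
Proof.
split=> [[a /= h]|[b ->]]; last first.
  by exists (inr b) => n; apply/Omega_at_tree; exists b; rewrite // size_mkseq.
have [b ab _] := (Omega_at_tree _ _).1 (h 0).
exists b; apply/funext => k.
have [b' ab' e] := (Omega_at_tree _ _).1 (h k.+1).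
have <- : b' = b by move: ab'; rewrite ab => -[].
by move: e => /esym; rewrite size_mkseq => /eq_mkseqP; apply.
Qed.

Lemma tree_rel_locally_const (f : (nat -> nat) -> seq bool -> nat -> bool) R l :
  (forall b k, locally_const (fun z => f z b k)) ->
  locally_const (fun z => tree_rel (f z) R l).
Proof.
move=> lf; case: R; try exact: locally_const_cst.
case: l => [|[s|?] [|[s'|b] [|? ?]]]; try exact: locally_const_cst.
by apply: (locally_const_comp (eq_op s)); exact: locally_const_mkseq.
Qed.

(** * Coding expanded tree structures by points of Baire space *)

Section Codes.
Variable phi : sigma11_sentence tau_d.
Let ar := so_arities phi.

Definition decode (n : nat) : node := odflt (inl [::]) (unpickle n).

Lemma decode_surj a : exists n, decode n = a.
Proof. by exists (pickle a); rewrite /decode pickleK. Qed.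

(* A point of Baire space codes a family of branches, an interpretation of the
   second-order variables of [phi] and an assignment of truth values to the
   subformulas of its matrix. *)
Definition index : Type :=
  (seq bool * nat + 'I_(size ar) * seq node + seq bool * seq nat)%type.

Definition at_index (z : nat -> nat) (j : index) : nat := z (pickle j).

Definition branch (z : nat -> nat) (b : seq bool) (k : nat) : bool :=
  at_index z (inl (inl (b, k))) != 0.

Definition so_rel (z : nat -> nat) (i : 'I_(size ar)) (l : seq node) : bool :=
  at_index z (inl (inr (i, l))) != 0.

Definition truth (z : nat -> nat) (p : seq bool) (v : seq nat) : nat :=
  at_index z (inr (p, v)).

Definition atom_truth (f : seq bool -> nat -> bool)
    (X : 'I_(size ar) -> seq node -> bool)
    (R : symbol (extend_vocabulary tau_d ar)) (s : seq nat) : bool :=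
  match R with
  | inl P => tree_rel f P (map decode s)
  | inr i => X i (map decode s)
  end.

(** The root value at the empty list is enough, because the matrix is a sentence. *)
Definition coded_models : set (nat -> nat) :=
  [set z | coherent decode (atom_truth (branch z) (so_rel z))
             (so_matrix phi) (truth z) /\
    truth z [::] [::] != 0].

Lemma at_index_locally_const j : locally_const (at_index ^~ j).
Proof. exact: locally_const_eval. Qed.

Lemma branch_locally_const b k : locally_const (fun z => branch z b k).
Proof. exact: (locally_const_comp (fun n => n != 0) (at_index_locally_const _)). Qed.

Lemma coded_models_closed : baire_closed coded_models.
Proof.
apply: baire_closedI; last first.
  apply: baire_closed_locally_const.
  exact: (locally_const_comp (fun n => is_true (n != 0)) (at_index_locally_const _)).
apply: coherent_closed => [[P|i] s|p v].
- by apply: tree_rel_locally_const; exact: branch_locally_const.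
- exact: (locally_const_comp (fun n => n != 0) (at_index_locally_const _)).
- exact: at_index_locally_const.
Qed.

Lemma coded_model_sigma11 z :
  coded_models z -> models_sigma11 (tree_structure (branch z)) phi.
Proof.
move=> [cz tz]; 
  pose X (i : 'I_(size ar)) (s : (nth 0 ar i).-tuple node) : Prop := so_rel z i s.
exists X => v; pose M := expansion (M := tree_structure (branch z)) X.
have : sat (M := M) (assign decode [::]) (so_matrix phi).
  apply/(coherent_sat (inhabits (inl [::] : node)) decode_surj _ cz) => //.
  by case.
by apply: sat_sentence; exact: so_matrix_sentence.
Qed.

Lemma sigma11_coded_model f : models_sigma11 (tree_structure f) phi ->
  exists2 z, coded_models z & branch z = f.
Proof.
move=> [X hX].
(* Codes speak of lists of any length; [Xb] is false on lists of the wrong length. *)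
pose Xb (i : 'I_(size ar)) l :=
  `[< exists2 t : (nth 0 ar i).-tuple node, tval t = l & X i t >].
have [t ct] := exists_coherent decode (atom_truth f Xb) (so_matrix phi).
pose w (j : index) : nat := match j with
  | inl (inl (b, k)) => f b k
  | inl (inr (i, l)) => Xb i l
  | inr (p, v) => t p v
  end.
pose z n := if unpickle n is Some j then w j else 0.
have zE j : at_index z j = w j by rewrite /at_index /z pickleK.
have fE : branch z = f.
  by apply/funext => b; apply/funext => k; rewrite /branch zE /=; case: (f b k).
have XE : so_rel z = Xb.
  by apply/funext => i; apply/funext => l; rewrite /so_rel zE /=; case: (Xb i l).
have tE : truth z = t by apply/funext => p; apply/funext => v; rewrite /truth zE.
exists z => //; rewrite /coded_models /= fE XE tE; split=> //.
apply/(coherent_sat (inhabits (inl [::] : node)) decode_surj _ ct).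
2: exact: hX.
case=> [P|i] s //=; split=> [Xs|/asboolP[u us]].
  by apply/asboolP; exists (map_tuple decode s).
by congr (X i _); apply: val_inj.
Qed.
End Codes.

(** * Comparable cones and the non-definability argument *)

Lemma cone_sub s s' : prefix s s' -> cone s' `<=` cone s.
Proof.
move=> /prefixP[u ->] x; rewrite /cone /= /restr size_cat /mkseq iotaD map_cat.
by move=> /eqP; rewrite eqseq_cat ?size_mkseq // => /andP[/eqP].
Qed.

Lemma cone_comparable s s' x : cone s x -> cone s' x -> prefix s s' || prefix s' s.
Proof.
rewrite /cone /= => <- <-; have [le|le] := orP (leq_total (size s) (size s')).
  by rewrite prefix_mkseq.
by rewrite (prefix_mkseq _ le) orbT.
Qed.

Lemma uncountable_not_sub (T : Type) (A C : set T) :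
  ~ countable A -> countable C -> exists2 x, A x & ~ C x.
Proof.
move=> uA cC; apply: contrapT => nx; apply: uA.
apply: sub_countable cC; apply: subset_card_le => x Ax.
by apply: contrapT => nCx; apply: nx; exists x.
Qed.

Theorem theorem17 (D : set cantor_space)
  (D_dense : seq_dense D)
  (D_gt_aleph0 : card_lt [set: nat] D)
  (D_lt_continuum : card_lt D [set: cantor_space])
  (D_locally_uncountable : exists U : set cantor_space,
     [/\ open U, U !=set0 &
       forall V : set cantor_space,
         open V -> V !=set0 -> V `<=` U -> ~ countable (D `&` V)]) :
  ~ sigma11_definable (K_ (~` D)).
Proof.
have [U [oU [u Uu] D_unc]] := D_locally_uncountable.
(* It remains to inject [2^omega] into [D]. *)
move=> [phi phiE]; case: D_lt_continuum => _; apply.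
have [n0 s0U] := open_sub_cone oU Uu; set s0 := restr u n0 in s0U.
have {}D_unc s : prefix s0 s -> ~ countable (D `&` cone s).
  move=> s0s; apply: D_unc; first exact: cone_open.
    by have [x _ xs] := D_dense s; exists x.
  by move=> x /(cone_sub s0s)/s0U.
(* The branches named by nodes incomparable with [s0] are frozen outside
   [cone s0], so that membership in K forces one of the others into [D]. *)
pose comparable b := prefix b s0 || prefix s0 b.
have /choice[h hP] : forall b, exists x, D x /\ cone b x.
  by move=> b; have [x Dx xb] := D_dense b; exists x.
pose F : set (nat -> nat) := [set z | coded_models phi z /\
  forall b, ~~ comparable b -> forall k, branch phi z b k = h b k].
pose pt (i : {b | comparable b}) z := branch phi z (val i).
have F_closed : baire_closed F.
  apply: baire_closedI; first exact: coded_models_closed.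
  do 3 apply: baire_closed_forall => ?; apply: baire_closed_locally_const.
  exact: (locally_const_comp (eq^~ _) (branch_locally_const _ _ _)).
have F_unhit (C : set (nat -> bool)) : countable C ->
    exists2 z, F z & forall i, ~ C (pt i z).
  move=> cC.
  have pick b : exists x, [/\ D x, cone b x & comparable b -> ~ C x].
    have [cb|cb] := boolP (comparable b); last by exists (h b); case: (hP b).
    (* The longer of [b] and [s0]: its cone lies in both cones, and [D] is uncountable there. *)
    pose b' := if prefix b s0 then s0 else b.
    have bb' : prefix b b' by rewrite /b'; case: ifP => // _; exact: prefix_refl.
    have s0b' : prefix s0 b'.
      rewrite /b'; case: ifP => [_|nb]; first exact: prefix_refl.
      by move: cb; rewrite /comparable nb.
    have [x [Dx xb'] nCx] := uncountable_not_sub (D_unc b' s0b') cC.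
    by exists x; split=> //; exact: cone_sub xb'.
  have [f0 f0P] := choice pick.
  pose f b := if comparable b then f0 b else h b.
  have fP b : D (f b) /\ cone b (f b).
    by rewrite /f; case: ifP => _; [case: (f0P b)|case: (hP b)].
  have [] := @sigma11_coded_model phi f.
    apply/phiE => s; have [Df fs] := fP s; exists (f s) => //; split.
      by apply/Omega_tree; exists s.
    by move=> /(_ Df).
  move=> z cz fE; exists z.
    by split=> // b ncb k; rewrite fE /f (negbTE ncb).
  move=> [b cb]; rewrite /pt fE /f /= cb.
  by case: (f0P b) => _ _; exact.
have [G [GF Gsep]] := perfect_separated_family F_closed
  (fun i k => branch_locally_const phi (val i) k) F_unhit.
have /choice[i iP] : forall a, exists i, D (pt i (G a)).
  move=> a; have [cGa hGa] := GF a.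
  (* Density is used at [s0] only: the branch of [D] found there cannot be a frozen one, since [h b]
     in [cone s0] would make [b] comparable with [s0]. *)
  have /phiE/(_ s0)[x [/Omega_tree[b xb] nnDx] xs0] := coded_model_sigma11 cGa.
  have Dx : D x by exact: contrapT.
  have [cb|ncb] := boolP (comparable b).
    by exists (exist _ b cb); rewrite /pt /= -xb.
  have xE : x = h b by rewrite xb; apply/funext => k; exact: hGa.
  case/negP: ncb; apply: (@cone_comparable _ _ x) => //.
  by rewrite xE; case: (hP b).
(* One member of [D] is taken from each family; disjointness makes the choice injective. *)
apply/pcard_leP/injfunPex; exists (fun a => pt (i a) (G a)) => // a b _ _ ab.
by apply: contrapT => nab; exact: (Gsep a b (i a) (i b) nab ab).
Qed.
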